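(* Let $1\le m\le n$ and let $K_{m,n}$ be the complete bipartite graph with class sizes $m$ and $n$. Then (a) $rc^\ell(K_{m,n})=n$ if $m=1$, and $rc^\ell(K_{m,n})=\min(\lceil \sqrt[m]{n}\,\rceil,4)$ if $m\ge 2$; (b) $src^\ell(K_{m,n})=\lceil\sqrt[m]{n}\,\rceil$.
   Context: An edge-coloured path is rainbow if all its edges have distinct colours; a geodesic is a shortest path between its endpoints. An (not necessarily proper) edge-colouring of a connected graph is rainbow connected (resp. strongly rainbow connected) if any two vertices are joined by a rainbow path (resp. rainbow geodesic). An $r$-edge-list assignment of $G$ assigns to each edge $e$ a set $L(e)\subset\mathbb N$ with $|L(e)|\ge r$; an $L$-edge-colouring is an edge-colouring $c$ with $c(e)\in L(e)$ for all $e$. $rc^\ell(G)$ (resp. $src^\ell(G)$) is the minimum integer $r$ such that for every $r$-edge-list assignment $L$ of $G$ there exists a rainbow connected (resp. strongly rainbow connected) $L$-edge-colouring of $G$. *)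

(* Defs.v *)
From HB Require Import structures.
From mathcomp Require Import all_boot all_order all_algebra.
From mathcomp Require Import classical_sets cardinality reals exp.

Set Implicit Arguments.
Unset Strict Implicit.
Unset Printing Implicit Defensive.

Import Order.TTheory GRing.Theory Num.Theory.

Record sgraph := SGraph {
  vertex :> finType;
  adj : rel vertex;
  adj_sym : symmetric adj;
  adj_irrefl : irreflexive adj
}.

Definition edges (G : sgraph) : {set {set G}} :=
  [set e : {set G} | [exists x : G, exists y : G, adj x y && (e == [set x; y])]].

(* The path with vertices x :: p, from x to y; its length is size p. *)
Definition gpath (G : sgraph) (x y : G) (p : seq G) : Prop :=
  [/\ path (@adj G) x p, uniq (x :: p) & last x p = y].

Definition path_edges (G : sgraph) (x : G) (p : seq G) : seq {set G} :=
  pairmap (fun u v => [set u; v]) x p.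

Definition geodesic (G : sgraph) (x y : G) (p : seq G) : Prop :=
  gpath x y p /\ forall q : seq G, gpath x y q -> size p <= size q.

(* Edge-colourings and list assignments are functions on all vertex sets, of
   which only the values on edges G are ever used. *)
Definition rainbow (G : sgraph) (c : {set G} -> nat) (x : G) (p : seq G) : Prop :=
  uniq (map c (path_edges x p)).

Definition rainbow_connected (G : sgraph) (c : {set G} -> nat) : Prop :=
  forall x y : G, exists p : seq G, gpath x y p /\ rainbow c x p.

Definition strongly_rainbow_connected (G : sgraph) (c : {set G} -> nat) : Prop :=
  forall x y : G, exists p : seq G, geodesic x y p /\ rainbow c x p.

(* `I_r is {0, ..., r - 1} and #<= compares cardinalities, so the lists have
   at least r elements and may be infinite. *)
Definition edge_list_assignment (G : sgraph) (r : nat)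
    (L : {set G} -> set nat) : Prop :=
  forall e : {set G}, e \in edges G -> (`I_r #<= L e)%card.

Definition list_colouring (G : sgraph) (L : {set G} -> set nat)
    (c : {set G} -> nat) : Prop :=
  forall e : {set G}, e \in edges G -> L e (c e).

Definition is_minimum (P : nat -> Prop) (k : nat) : Prop :=
  P k /\ forall r : nat, P r -> k <= r.

(* is_rcl G k reads "rc^l(G) = k", and is_srcl G k reads "src^l(G) = k". *)
Definition is_rcl (G : sgraph) (k : nat) : Prop :=
  is_minimum (fun r => forall L : {set G} -> set nat,
    edge_list_assignment r L ->
    exists c : {set G} -> nat, list_colouring L c /\ rainbow_connected c) k.

Definition is_srcl (G : sgraph) (k : nat) : Prop :=
  is_minimum (fun r => forall L : {set G} -> set nat,
    edge_list_assignment r L ->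
    exists c : {set G} -> nat,
      list_colouring L c /\ strongly_rainbow_connected c) k.

Definition Kmn_adj (m n : nat) (x y : 'I_m + 'I_n) : bool :=
  match x, y with
  | inl _, inr _ | inr _, inl _ => true
  | _, _ => false
  end.

Lemma Kmn_adj_sym (m n : nat) : symmetric (@Kmn_adj m n).
Proof. by case=> ? [] ?. Qed.

Lemma Kmn_adj_irrefl (m n : nat) : irreflexive (@Kmn_adj m n).
Proof. by case. Qed.

Definition Kmn (m n : nat) : sgraph :=
  SGraph (@Kmn_adj_sym m n) (@Kmn_adj_irrefl m n).

(* Num.ceil is integer-valued; the m-th root is nonnegative, so taking the
   absolute value only casts its ceiling to nat. *)
Definition ceil_root (R : realType) (m n : nat) : nat :=
  `|Num.ceil (powR (n%:R : R) (m%:R : R)^-1)%R|%N.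

(* Main.v *)
Require Import Defs.
From HB Require Import structures.
From mathcomp Require Import all_boot all_order all_algebra.
From mathcomp Require Import boolp classical_sets functions cardinality.
From mathcomp Require Import reals exp.

(** The edges at the [n]-side vertex [j] form column [j] of an [m x n] matrix
    of colours, and two [n]-side vertices are joined by a rainbow path of length
    two iff their columns differ.  With constant lists of size [r] there are at
    most [r ^ m] columns, and a rainbow path between two [n]-side vertices has
    length two if [r <= 3] or [m = 1]: these are the lower bounds.

    For the upper bounds, each column [j < m] is chosen so that its entries
    below the diagonal differ from the one on it, which separates the rows
    because [m <= n].  If [n <= r ^ m], column [j] still has more than [j]
    candidates ([r ^ m] of them if [m <= j], and at least [r ^ j] otherwise), so
    distinct columns can be picked greedily.  With lists of size 4 and [2 <= m],
    let column 0 start with [c <> d], and let every other column start with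
    [a <> b] outside [{c, d}]: two [n]-side vertices with equal columns are then
    joined through rows 0, 1 and column 0 by a path coloured [a, c, d, b]. *)

Set Implicit Arguments.
Unset Strict Implicit.
Unset Printing Implicit Defensive.

Import Order.TTheory GRing.Theory Num.Theory.

Lemma ceil_root_leq (R : realType) (m n r : nat) :
  0 < m -> (ceil_root R m n <= r) = (n <= r ^ m).
Proof.
move=> m_gt0; rewrite /ceil_root; set x := powR _ _.
have x_ge0 : (0 <= x)%R by exact: powR_ge0.
have xX : (x ^+ m = n%:R)%R.
  by rewrite -powR_mulrn // -powRrM mulVf ?powRr1 ?ler0n // pnatr_eq0 -lt0n.
have ceil_x_ge0 : (0 <= Num.ceil x)%R.
  by rewrite ceil_ge0 (lt_le_trans _ x_ge0) // ltrN10.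
rewrite -lez_nat gez0_abs // ceil_le_int -[(r%:~R)%R]/(r%:R)%R.
by rewrite -(ler_pXn2r m_gt0) ?nnegrE ?ler0n // xX -natrX ler_nat.
Qed.

Lemma expn_base_gt0 (m r : nat) : 0 < m -> m <= r ^ m -> 0 < r.
Proof.
by move=> m_gt0 /(leq_trans m_gt0); rewrite expn_gt0 (gtn_eqF m_gt0) orbF.
Qed.

Lemma expn_base_gt1 (m r : nat) : 1 < m -> m <= r ^ m -> 1 < r.
Proof.
move=> m_gt1 m_le_rX; rewrite ltnNge; apply: contraTN m_le_rX => r_le1.
by rewrite -ltnNge (leq_ltn_trans _ m_gt1) // -(exp1n m) leq_exp2r // ltnW.
Qed.

Lemma card_ge_II_uniq_seq (T : pointedType) (r : nat) (B : set T) :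
  (`I_r #<= B)%card ->
  exists s : seq T, [/\ uniq s, size s = r & forall x, x \in s -> B x].
Proof.
move=> /pcard_leP[f]; exists [seq f i | i <- iota 0 r]; split.
- rewrite map_inj_in_uniq ?iota_uniq // => i k.
  by rewrite !mem_iota => i_lt k_lt; apply: (@inj _ _ _ f); rewrite inE.
- by rewrite size_map size_iota.
- move=> _ /mapP[i + ->]; rewrite mem_iota => i_lt.
  exact: (@funS _ _ _ _ f).
Qed.

Lemma leq_size_filter_notin (T : eqType) (s l : seq T) :
  uniq s -> size s <= size [seq x <- s | x \notin l] + size l.
Proof.
move=> s_uniq; rewrite -(count_predC [in l]) addnC size_filter leq_add2l.
rewrite -size_filter; apply: uniq_leq_size; first exact: filter_uniq.
by move=> x; rewrite mem_filter => /andP[].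
Qed.

Lemma exists_mem_notin (T : eqType) (s l : seq T) :
  uniq s -> size l < size s -> exists2 x, x \in s & x \notin l.
Proof.
move=> s_uniq l_lt_s.
have : 0 < size [seq x <- s | x \notin l].
  rewrite -(ltn_add2r (size l)); exact: leq_trans (leq_size_filter_notin l _).
by rewrite size_filter -has_count => /hasP[x]; exists x.
Qed.

Lemma greedy_list_colouring (T : eqType) (n : nat) (e : rel 'I_n)
    (A : 'I_n -> seq T) :
  (forall i, uniq (A i)) ->
  (forall i : 'I_n, #|[pred k : 'I_n | (k < i) && e k i]| < size (A i)) ->
  exists2 f : 'I_n -> T, forall i, f i \in A i &
    forall k i : 'I_n, k < i -> e k i -> f k != f i.
Proof.
move=> A_uniq A_size.
suff /(_ n)[f fA f_proper] t : exists2 f : 'I_n -> T, forall i, f i \in A i &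
    forall k i : 'I_n, k < i < t -> e k i -> f k != f i.
  by exists f => // k i k_lt_i; apply: f_proper; rewrite k_lt_i ltn_ord.
elim: t => [|t [f fA f_proper]].
  have /fin_all_exists[f fA] i : exists x, x \in A i.
    have [|x xA _] := @exists_mem_notin _ (A i) [::] (A_uniq i).
      exact: leq_ltn_trans (A_size i).
    by exists x.
  by exists f => // k i; rewrite ltn0 andbF.
have [n_le_t|t_lt_n] := leqP n t.
  exists f => // k i /andP[k_lt_i _]; apply: f_proper.
  by rewrite k_lt_i (leq_trans (ltn_ord i)).
pose j := Ordinal t_lt_n; pose earlier := [pred k : 'I_n | (k < j) && e k j].
have [|x xA xP] :=
    @exists_mem_notin _ (A j) [seq f k | k in earlier] (A_uniq j).
  by rewrite size_image A_size.
exists (fun i => if i == j then x else f i) => [i|k i].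
  by case: eqP => [->|].
move=> /andP[k_lt_i i_le_t] e_ki.
have -> : (k == j) = false by rewrite -val_eqE ltn_eqF // (leq_trans k_lt_i).
have [i_j|i_neq_j] := eqVneq i j.
  by apply: contraNneq xP => <-; rewrite fintype.image_f // inE -i_j k_lt_i.
by rewrite f_proper // k_lt_i ltn_neqAle -ltnS i_le_t andbT.
Qed.

Lemma greedy_distinct_representatives (T : eqType) (n : nat)
    (A : 'I_n -> seq T) :
  (forall j, uniq (A j)) -> (forall j : 'I_n, j < size (A j)) ->
  exists2 f : 'I_n -> T, injective f & forall j, f j \in A j.
Proof.
move=> A_uniq A_size.
have [|f fA f_neq] := @greedy_list_colouring _ _ (fun _ _ => true) A A_uniq.
  move=> j; rewrite -sum1_card (eq_bigl (fun k : 'I_n => k < j)).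
    rewrite -(big_ord_widen n (fun=> 1) (ltnW (ltn_ord j))).
    by rewrite sum1_card card_ord.
  by move=> k; rewrite inE andbT.
exists f => // j k f_jk; apply/eqP; rewrite -val_eqE; apply/negPn.
by rewrite neq_ltn; apply/norP; split; apply/negP => /f_neq /(_ isT);
  rewrite f_jk eqxx.
Qed.

Definition pi_seq (I : finType) (T : eqType) (S : I -> seq T) :
    seq {ffun I -> T} :=
  codom (fun h : {dffun forall i, 'I_(size (S i))} =>
           [ffun i => tnth (in_tuple (S i)) (h i)]).

Section PiSeq.
Variables (I : finType) (T : eqType).
Implicit Types S : I -> seq T.

Lemma pi_seq_uniq S : (forall i, uniq (S i)) -> uniq (pi_seq S).
Proof.
move=> S_uniq; apply/injectiveP => h k /ffunP hk; apply/ffunP => i.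
by have := hk i; rewrite !ffunE => /(tuple_uniqP (in_tuple (S i)) (S_uniq i)).
Qed.

Lemma size_pi_seq S : size (pi_seq S) = \prod_i size (S i).
Proof.
rewrite size_codom card_dep_ffun foldrE big_map big_enum.
by apply: eq_bigr => i _; rewrite card_ord.
Qed.

Lemma mem_pi_seq S v : v \in pi_seq S -> forall i, v i \in S i.
Proof.
move=> /codomP[h ->] i; rewrite ffunE.
exact: (mem_tnth (h i) (in_tuple (S i))).
Qed.

End PiSeq.

Section MatrixColumns.
Variables (T : eqType) (m n : nat).

Definition rows_distinct (C : 'I_m -> 'I_n -> T) : Prop :=
  forall i i', i != i' -> exists j, C i j != C i' j.

Definition columns_distinct (C : 'I_m -> 'I_n -> T) : Prop :=
  forall j j', j != j' -> exists i, C i j != C i j'.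

(* The colours are listed in the order in which a path of length four from
   column [j] through row [i0], column [z] and row [i1] to a column equal to [j]
   meets them. *)
Definition hub_column (C : 'I_m -> 'I_n -> T) (i0 i1 : 'I_m) (z : 'I_n) :
    Prop :=
  forall j, j != z -> uniq [:: C i0 j; C i0 z; C i1 z; C i1 j].

(* Void for [m <= t]: the columns that miss the diagonal are unconstrained. *)
Definition pivoted (t : nat) (v : 'I_m -> T) : Prop :=
  forall k i : 'I_m, k = t :> nat -> k < i -> v k != v i.

Lemma pivoted_rows_distinct (C : 'I_m -> 'I_n -> T) :
  m <= n -> (forall j : 'I_n, pivoted j (C^~ j)) -> rows_distinct C.
Proof.
move=> m_le_n C_pivoted i i'; rewrite -val_eqE neq_ltn => /orP[lt_ii'|lt_i'i].
  by exists (widen_ord m_le_n i); exact: C_pivoted.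
by exists (widen_ord m_le_n i'); rewrite eq_sym; exact: C_pivoted.
Qed.

Lemma exists_pivoted_columns (r : nat) (k : 'I_m) (s : 'I_m -> seq T) :
  (forall i, uniq (s i)) -> (forall i : 'I_m, i < k -> r <= size (s i)) ->
  0 < size (s k) -> (forall i : 'I_m, k < i -> 1 < size (s i)) ->
  exists A : seq {ffun 'I_m -> T},
    [/\ uniq A, r ^ k <= size A &
        forall v, v \in A -> (forall i, v i \in s i) /\ pivoted k v].
Proof.
move=> s_uniq s_above s_pivot s_below.
have [x xs _] := @exists_mem_notin _ _ [::] (s_uniq k) s_pivot.
pose S (i : 'I_m) :=
  if i < k then s i
  else if i == k then [:: x] else [seq y <- s i | y \notin [:: x]].
have S_uniq i : uniq (S i).
  by rewrite /S; case: ifP => // _; case: ifP => // _; exact: filter_uniq.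
exists (pi_seq S); split; first exact: pi_seq_uniq.
  have -> : r ^ k = \prod_(i < m) (if i < k then r else 1).
    rewrite -big_mkcond -(big_ord_widen _ (fun=> r) (ltnW (ltn_ord k))).
    by rewrite prod_nat_const card_ord.
  rewrite size_pi_seq; apply: leq_prod => i _; rewrite /S.
  case: ifPn => [/s_above //|].
  rewrite -leqNgt leq_eqVlt => /predU1P[k_i|lt_ki].
    by rewrite ifT //; apply/eqP/val_inj.
  rewrite ifF; last by rewrite -val_eqE gtn_eqF.
  rewrite -(leq_add2r (size [:: x])).
  exact: leq_trans (s_below i lt_ki) (leq_size_filter_notin _ (s_uniq i)).
move=> v /mem_pi_seq vS; split=> [i|k' i /val_inj -> lt_ki].
  have := vS i; rewrite /S; case: ifP => // _; case: eqP => [->|_].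
    by rewrite inE => /eqP ->.
  by rewrite mem_filter => /andP[].
have := vS k; have := vS i; rewrite /S ltnn eqxx ltnNge (ltnW lt_ki) /=.
rewrite -val_eqE gtn_eqF // mem_filter !inE => /andP[+ _] /eqP ->.
by rewrite eq_sym.
Qed.

Lemma exists_gt_pivoted_columns (r t : nat) (s : 'I_m -> seq T) :
  m <= r ^ m -> t < r ^ m ->
  (forall i, uniq (s i)) -> (forall i, size (s i) = r) ->
  exists A : seq {ffun 'I_m -> T},
    [/\ uniq A, t < size A &
        forall v, v \in A -> (forall i, v i \in s i) /\ pivoted t v].
Proof.
move=> m_le_rX t_lt_rX s_uniq s_size; have [m_le_t|t_lt_m] := leqP m t.
  exists (pi_seq s); split; first exact: pi_seq_uniq.
    rewrite size_pi_seq (eq_bigr (fun=> r)) => [|i _]; last exact: s_size.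
    by rewrite prod_nat_const card_ord.
  move=> v /mem_pi_seq vs; split=> // k i k_t _.
  by have := ltn_ord k; rewrite k_t ltnNge m_le_t.
have r_gt0 : 0 < r.
  by rewrite (expn_base_gt0 _ m_le_rX) // (leq_ltn_trans _ t_lt_m).
have r_gt1 i : i < m -> 0 < i -> 1 < r.
  move=> i_lt_m i_gt0.
  by rewrite (expn_base_gt1 _ m_le_rX) // (leq_ltn_trans i_gt0).
have [|||A [A_uniq A_size AP]] :=
  @exists_pivoted_columns r (Ordinal t_lt_m) s s_uniq.
- by move=> i _; rewrite s_size.
- by rewrite s_size.
- by move=> i lt_ti; rewrite s_size (r_gt1 i) // (leq_ltn_trans _ lt_ti).
exists A; split=> //; apply: leq_trans A_size => /=.
by case: (posnP t) => [-> //|t_gt0]; apply/ltn_expl/(r_gt1 t).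
Qed.

Lemma exists_distinct_rows_columns (r : nat) (s : 'I_m -> 'I_n -> seq T) :
  m <= n -> n <= r ^ m ->
  (forall i j, uniq (s i j)) -> (forall i j, size (s i j) = r) ->
  exists2 C : 'I_m -> 'I_n -> T, forall i j, C i j \in s i j &
    rows_distinct C /\ columns_distinct C.
Proof.
move=> m_le_n n_le_rX s_uniq s_size.
have /fin_all_exists[A AP] (j : 'I_n) : exists A : seq {ffun 'I_m -> T},
    [/\ uniq A, j < size A &
        forall v, v \in A -> (forall i, v i \in s i j) /\ pivoted j v].
  apply: (exists_gt_pivoted_columns (r := r)) => //.
    exact: leq_trans n_le_rX.
  exact: leq_trans (ltn_ord j) n_le_rX.
have [||f f_inj fA] := @greedy_distinct_representatives _ n A.
- by move=> j; have [] := AP j.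
- by move=> j; have [] := AP j.
exists (fun i j => f j i) => [i j|].
  by have [_ _ /(_ _ (fA j))[]] := AP j.
split.
  by apply: pivoted_rows_distinct => // j; have [_ _ /(_ _ (fA j))[]] := AP j.
move=> j j' jj'; apply/existsP; apply: contraR jj'; rewrite negb_exists.
by move=> /forallP f_jj'; apply/eqP/f_inj/ffunP => i; apply/eqP/negPn.
Qed.

Lemma exists_pivoted_column_avoiding (t : nat) (l : seq T) (s : 'I_m -> seq T) :
  (forall i, uniq (s i)) -> (forall i, (size l).+1 < size (s i)) ->
  exists v : 'I_m -> T,
    [/\ forall i, v i \in s i, forall i, v i \notin l, pivoted t v &
        forall i0 i1 : 'I_m, i0 = 0 :> nat -> i1 = 1 :> nat -> v i0 != v i1].
Proof.
move=> s_uniq s_size.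
(* Row [i] only has to differ from one earlier row: the pivot if that lies
   above it, and row 0 otherwise. *)
pose parent (i : 'I_m) := if t < i then t else 0.
have [||v vs v_neq] := @greedy_list_colouring T m
    (fun k i => k == parent i :> nat) (fun i => [seq x <- s i | x \notin l]).
- by move=> i; exact: filter_uniq.
- move=> i; apply: (@leq_ltn_trans 1).
    apply/card_le1_eqP => k k'; rewrite !inE.
    move=> /andP[_ /eqP k_i] /andP[_ /eqP k'_i].
    by apply: val_inj; rewrite /= k_i k'_i.
  rewrite -(ltn_add2r (size l)) add1n.
  exact: leq_trans (leq_size_filter_notin l (s_uniq i)).
exists v; split=> [i|i|k i k_t lt_ki|i0 i1 i0_0 i1_1].
- by have := vs i; rewrite mem_filter => /andP[].
- by have := vs i; rewrite mem_filter => /andP[].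
- by apply: v_neq; rewrite // /parent -k_t lt_ki.
- by apply: v_neq; rewrite ?i0_0 ?i1_1 // /parent i1_1; case: (t).
Qed.

Lemma exists_hub_column (s : 'I_m -> 'I_n -> seq T) :
  1 < m -> m <= n ->
  (forall i j, uniq (s i j)) -> (forall i j, 3 < size (s i j)) ->
  exists2 C : 'I_m -> 'I_n -> T, forall i j, C i j \in s i j &
    rows_distinct C /\ exists i0 i1 z, hub_column C i0 i1 z.
Proof.
move=> m_gt1 m_le_n s_uniq s_size.
pose i0 := Ordinal (ltnW m_gt1); pose i1 := Ordinal m_gt1.
pose z := Ordinal (leq_trans (ltnW m_gt1) m_le_n).
have [||v [vs _ v_pivoted v_neq]] :=
  @exists_pivoted_column_avoiding 0 [::] (s^~ z) => [//|i|].
  exact: leq_trans (s_size i z).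
have /fin_all_exists[w wP] (j : 'I_n) :=
  @exists_pivoted_column_avoiding j [:: v i0; v i1] (s^~ j)
    (s_uniq^~ j) (s_size^~ j).
exists (fun i j => if j == z then v i else w j i) => [i j|].
  by case: eqP => [->|_] //; have [] := wP j.
split; last first.
  exists i0, i1, z => j /negPf j_z; rewrite eqxx j_z.
  have [_ w_notin _ w_neq] := wP j.
  have := w_notin i0; have := w_notin i1; rewrite /= !inE !negb_or.
  move=> /andP[w1_v0 w1_v1] /andP[-> ->].
  by rewrite w_neq // v_neq // ![v _ == w j i1]eq_sym w1_v0 w1_v1.
apply: pivoted_rows_distinct => // j; case: eqP => [->|_] //.
by have [] := wP j.
Qed.

End MatrixColumns.

Section SimpleGraphs.
Variable G : sgraph.
Implicit Types (c : {set G} -> nat) (L : {set G} -> set nat) (x y z : G).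
Implicit Types (Q : ({set G} -> nat) -> Prop) (r : nat).

Definition choosable Q r : Prop :=
  forall L, edge_list_assignment r L -> exists c, list_colouring L c /\ Q c.

Definition rainbow_joined c x y : Prop :=
  exists p, gpath x y p /\ rainbow c x p.

Definition rainbow_geodesic c x y : Prop :=
  exists p, geodesic x y p /\ rainbow c x p.

Lemma choosable_sub Q Q' r :
  (forall c, Q c -> Q' c) -> choosable Q r -> choosable Q' r.
Proof.
by move=> QQ' Q_r L /Q_r[c [Lc Qc]]; exists c; split=> //; exact: QQ'.
Qed.

Lemma choosable_bounded Q r :
  choosable Q r -> exists2 c, forall e, e \in edges G -> c e < r & Q c.
Proof.
move=> Q_r; have [e _|c [c_lt Qc]] := Q_r (fun=> `I_r); first exact: card_lexx.
by exists c.
Qed.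

Lemma edge_list_assignment_seqs r L :
  edge_list_assignment r L ->
  exists s : {set G} -> seq nat, forall e, e \in edges G ->
    [/\ uniq (s e), size (s e) = r & forall a, a \in s e -> L e a].
Proof.
move=> L_r; apply: (fin_all_exists (P := fun e s => e \in edges G ->
  [/\ uniq s, size s = r & forall a, a \in s -> L e a])) => e.
have [/L_r/card_ge_II_uniq_seq[s sP]|_] := boolP (e \in edges G).
  by exists s.
by exists [::].
Qed.

Lemma path_edges_sub x (p : seq G) :
  path (@adj G) x p -> {subset path_edges x p <= edges G}.
Proof.
elim: p x => //= y p IHp x /andP[xy yp] e.
rewrite inE => /predU1P[->|]; last exact: IHp.
rewrite inE; apply/existsP; exists x; apply/existsP; exists y.
by rewrite xy eqxx.
Qed.

Lemma size_rainbow_leq r c x y (p : seq G) :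
  (forall e, e \in edges G -> c e < r) -> gpath x y p -> rainbow c x p ->
  size p <= r.
Proof.
move=> c_lt [xp _ _] /uniq_leq_size c_size.
rewrite -(size_iota 0 r) -(size_pairmap (fun u v => [set u; v]) x p).
rewrite -(size_map c).
apply: c_size => _ /mapP[e /(path_edges_sub xp)/c_lt e_lt ->].
by rewrite mem_iota.
Qed.

Lemma geodesic_adj x y : adj x y -> geodesic x y [:: y].
Proof.
move=> xy; have x_neq_y : x != y.
  by apply: contraTneq xy => ->; rewrite adj_irrefl.
split; first by split=> //=; rewrite ?xy ?inE ?x_neq_y.
by move=> [|z q] // [_ _ x_y]; rewrite [x]x_y eqxx in x_neq_y.
Qed.

Lemma geodesic_midpoint x z y :
  x != y -> ~~ adj x y -> adj x z -> adj z y -> geodesic x y [:: z; y].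
Proof.
move=> x_neq_y nadj_xy xz zy; split.
  split=> //=; first by rewrite xz zy.
  rewrite !inE !negb_or x_neq_y !andbT; apply/andP; split.
    by apply: contraTneq xz => ->; rewrite adj_irrefl.
  by apply: contraTneq zy => ->; rewrite adj_irrefl.
move=> [|a [|b q]] [/= xa _ a_y] //; first by rewrite a_y eqxx in x_neq_y.
by rewrite andbT a_y in xa; rewrite xa in nadj_xy.
Qed.

Lemma rainbow_geodesic_refl c x : rainbow_geodesic c x x.
Proof. by exists [::]. Qed.

Lemma rainbow_geodesic_adj c x y : adj x y -> rainbow_geodesic c x y.
Proof. by move=> xy; exists [:: y]; split=> //; exact: geodesic_adj. Qed.

Lemma rainbow_geodesic_midpoint c x z y :
  ~~ adj x y -> adj x z -> adj z y -> c [set x; z] != c [set z; y] ->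
  rainbow_geodesic c x y.
Proof.
move=> nadj_xy xz zy c_neq; exists [:: z; y]; split.
  apply: geodesic_midpoint => //; apply: contraNneq c_neq => ->.
  by rewrite finset.setUC.
by rewrite /rainbow /= inE c_neq.
Qed.

Lemma rainbow_geodesic_joined c x y :
  rainbow_geodesic c x y -> rainbow_joined c x y.
Proof. by move=> [p [[xpy _] p_rainbow]]; exists p. Qed.

Lemma strongly_rainbow_connectedW c :
  strongly_rainbow_connected c -> rainbow_connected c.
Proof. by move=> c_strong x y; apply/rainbow_geodesic_joined/c_strong. Qed.

End SimpleGraphs.

Section CompleteBipartite.
Variables m n : nat.
Implicit Types (c : {set Kmn m n} -> nat) (C : 'I_m -> 'I_n -> nat).

Definition Kmn_edge (i : 'I_m) (j : 'I_n) : {set Kmn m n} :=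
  [set (inl i : Kmn m n); (inr j : Kmn m n)].

Definition edge_matrix c (i : 'I_m) (j : 'I_n) : nat := c (Kmn_edge i j).

Lemma Kmn_edgeC (i : 'I_m) (j : 'I_n) :
  [set (inr j : Kmn m n); (inl i : Kmn m n)] = Kmn_edge i j.
Proof. exact: finset.setUC. Qed.

Lemma Kmn_edge_inj (i i' : 'I_m) (j j' : 'I_n) :
  Kmn_edge i j = Kmn_edge i' j' -> i = i' /\ j = j'.
Proof.
move=> /setP e; have := e (inl i); have := e (inr j).
by rewrite !inE !eqxx !orbT /= => /esym/eqP[->] /esym/orP[/eqP[->]|].
Qed.

Lemma mem_edges_Kmn (e : {set Kmn m n}) :
  e \in edges (Kmn m n) <-> exists i j, e = Kmn_edge i j.
Proof.
rewrite inE; split=> [/existsP[[i|j]] /existsP[[i'|j']] /andP[// _ /eqP ->]|].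
- by exists i, j'.
- by exists i', j; rewrite Kmn_edgeC.
- move=> [i [j ->]]; apply/existsP; exists (inl i); apply/existsP.
  by exists (inr j); rewrite /= eqxx.
Qed.

(* Off the edges the value is the junk value [0]. *)
Definition matrix_colouring C (e : {set Kmn m n}) : nat :=
  if [pick ij : 'I_m * 'I_n | e == Kmn_edge ij.1 ij.2] is Some ij
  then C ij.1 ij.2 else 0.

Lemma matrix_colouringK C : edge_matrix (matrix_colouring C) = C.
Proof.
apply/eq2_fun => i j; rewrite /edge_matrix /matrix_colouring.
case: pickP => [[i' j'] /eqP /Kmn_edge_inj[-> ->] //|].
by move=> /(_ (i, j)); rewrite eqxx.
Qed.

Lemma Kmn_choosable (P : ('I_m -> 'I_n -> nat) -> Prop)
    (Q : ({set Kmn m n} -> nat) -> Prop) (r : nat) :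
  (forall c, P (edge_matrix c) -> Q c) ->
  (forall s : 'I_m -> 'I_n -> seq nat,
    (forall i j, uniq (s i j)) -> (forall i j, size (s i j) = r) ->
    exists2 C, forall i j, C i j \in s i j & P C) ->
  choosable Q r.
Proof.
move=> PQ P_r L /edge_list_assignment_seqs[s sP].
have {}sP i j : [/\ uniq (s (Kmn_edge i j)), size (s (Kmn_edge i j)) = r &
    forall x, x \in s (Kmn_edge i j) -> L (Kmn_edge i j) x].
  by apply: sP; apply/mem_edges_Kmn; exists i, j.
have [i j|i j|C Cs PC] := P_r (fun i j => s (Kmn_edge i j)).
- by have [] := sP i j.
- by have [] := sP i j.
exists (matrix_colouring C); split; last first.
  by apply: PQ; rewrite matrix_colouringK.
move=> e /mem_edges_Kmn[i [j ->]].
rewrite -/(edge_matrix _ i j) matrix_colouringK.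
by have [_ _] := sP i j; apply.
Qed.

Lemma rainbow_geodesic_rows c i i' j :
  edge_matrix c i j != edge_matrix c i' j ->
  rainbow_geodesic c (inl i) (inl i').
Proof.
move=> c_neq; apply: (@rainbow_geodesic_midpoint (Kmn m n) _ _ (inr j)) => //.
by rewrite Kmn_edgeC.
Qed.

Lemma rainbow_geodesic_columns c i j j' :
  edge_matrix c i j != edge_matrix c i j' ->
  rainbow_geodesic c (inr j) (inr j').
Proof.
move=> c_neq; apply: (@rainbow_geodesic_midpoint (Kmn m n) _ _ (inl i)) => //.
by rewrite Kmn_edgeC.
Qed.

Lemma distinct_strongly_rainbow_connected c :
  rows_distinct (edge_matrix c) -> columns_distinct (edge_matrix c) ->
  strongly_rainbow_connected c.
Proof.
move=> rows cols x y.
have [->|] := eqVneq x y; first exact: rainbow_geodesic_refl.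
case: x y => [i|j] [i'|j'] neq; try exact: rainbow_geodesic_adj.
- by have [j] := rows i i' neq; exact: rainbow_geodesic_rows.
- by have [i] := cols j j' neq; exact: rainbow_geodesic_columns.
Qed.

Lemma rainbow_joined_hub c i0 i1 z j j' :
  hub_column (edge_matrix c) i0 i1 z -> j != z -> j' != z -> j != j' ->
  edge_matrix c i1 j = edge_matrix c i1 j' -> rainbow_joined c (inr j) (inr j').
Proof.
move=> hub j_z j'_z jj' i1_jj'; have c_uniq := hub j j_z.
have i01 : i0 != i1.
  by apply: contraTneq c_uniq => ->; rewrite /= !inE eqxx !orbT.
exists [:: inl i0; inr z; inl i1; inr j']; split.
  split=> //=; rewrite !inE !negb_or /= andbT.
  rewrite !(inj_eq (@inr_inj _ _)) (inj_eq (@inl_inj _ _)).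
  by rewrite j_z jj' i01 eq_sym j'_z.
rewrite /rainbow /= !Kmn_edgeC -!/(Kmn_edge _ _) -!/(edge_matrix c _ _).
by rewrite -i1_jj'.
Qed.

Lemma hub_column_rainbow_connected c i0 i1 z :
  rows_distinct (edge_matrix c) -> hub_column (edge_matrix c) i0 i1 z ->
  rainbow_connected c.
Proof.
move=> rows hub x y; rewrite -/(rainbow_joined c x y).
have [->|] := eqVneq x y.
  exact/rainbow_geodesic_joined/rainbow_geodesic_refl.
case: x y => [i|j] [i'|j'] neq;
  try exact/rainbow_geodesic_joined/rainbow_geodesic_adj.
  have [j c_neq] := rows i i' neq.
  exact/rainbow_geodesic_joined/(rainbow_geodesic_rows c_neq).
have hub_i0 k : k != z -> edge_matrix c i0 k != edge_matrix c i0 z.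
  by move=> /hub; rewrite /= !inE !negb_or => /andP[/andP[]].
have column i : edge_matrix c i j != edge_matrix c i j' ->
    rainbow_joined c (inr j) (inr j').
  move=> c_neq.
  exact/rainbow_geodesic_joined/(rainbow_geodesic_columns c_neq).
have [j_z|j_z] := eqVneq j z.
  by apply: (column i0); rewrite j_z eq_sym hub_i0 // -j_z eq_sym.
have [j'_z|j'_z] := eqVneq j' z.
  by apply: (column i0); rewrite j'_z hub_i0.
have [c_eq|] := eqVneq (edge_matrix c i1 j) (edge_matrix c i1 j'); last first.
  exact: column.
exact: rainbow_joined_hub hub j_z j'_z neq c_eq.
Qed.

Lemma size_path_Kmn (x : Kmn m n) p :
  path (@adj (Kmn m n)) x p -> size p <= (count is_inl p).*2 + is_inl x.
Proof.
elim: p x => //= y p IHp x /andP[xy /IHp]; case: x y xy => [i|j] [i'|j'] //= _.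
  by rewrite add0n addn0 addn1.
by rewrite add1n addn0 addn1 doubleS.
Qed.

Lemma size_gpath_Kmn (j : 'I_n) (y : Kmn m n) p :
  gpath (inr j : Kmn m n) y p -> size p <= m.*2.
Proof.
move=> [/size_path_Kmn + /andP[_ p_uniq] _]; rewrite addn0 => /leq_trans; apply.
pose lefts : seq (Kmn m n) := [seq inl i | i <- enum 'I_m].
rewrite leq_double -size_filter.
have lefts_size : size lefts = m by rewrite size_map size_enum_ord.
rewrite -[leqRHS]lefts_size; apply: uniq_leq_size => [|[i _|k]].
- exact: filter_uniq.
- by rewrite map_f // mem_enum.
- by rewrite mem_filter.
Qed.

Lemma rainbow_columns_distinct c (j j' : 'I_n) p :
  gpath (inr j : Kmn m n) (inr j') p -> rainbow c (inr j : Kmn m n) p ->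
  size p <= 3 -> j != j' -> exists i, edge_matrix c i j != edge_matrix c i j'.
Proof.
case: p => [|[i|?] [|[?|?] [|[?|?] [|? ?]]]] [] //=.
  by move=> _ _ [->]; rewrite eqxx.
move=> _ _ [->]; rewrite /rainbow /= Kmn_edgeC -/(Kmn_edge i j') inE.
by move=> /andP[c_neq _] _ _; exists i.
Qed.

Lemma columns_distinct_leq_expn (r : nat) C :
  (forall i j, C i j < r) -> columns_distinct C -> n <= r ^ m.
Proof.
move=> C_lt cols; pose column j := [ffun i : 'I_m => Ordinal (C_lt i j)].
suff /leq_card : injective column by rewrite card_ffun !card_ord.
move=> j j' /ffunP col_eq; apply/eqP/negPn/negP => /cols[i].
by have := col_eq i; rewrite !ffunE => /(congr1 val) /= ->; rewrite eqxx.
Qed.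

Lemma short_rainbow_paths_leq_expn (r : nat) c :
  (forall e, e \in edges (Kmn m n) -> c e < r) ->
  (forall j j' : 'I_n, j != j' -> exists p : seq (Kmn m n),
    [/\ gpath (inr j : Kmn m n) (inr j') p, rainbow c (inr j : Kmn m n) p &
        size p <= 3]) ->
  n <= r ^ m.
Proof.
move=> c_lt joined; apply: (columns_distinct_leq_expn (C := edge_matrix c)).
  by move=> i j; apply/c_lt/mem_edges_Kmn; exists i, j.
move=> j j' jj'; have [p [jpj' p_rainbow p_size]] := joined j j' jj'.
exact: rainbow_columns_distinct p_size jj'.
Qed.

Lemma rainbow_choosable_leq_expn (r : nat) :
  minn r m.*2 <= 3 -> choosable (@rainbow_connected (Kmn m n)) r -> n <= r ^ m.
Proof.
move=> r_m_le3 /choosable_bounded[c c_lt c_conn].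
apply: (short_rainbow_paths_leq_expn c_lt) => j j' _.
have [p [jpj' p_rainbow]] := c_conn (inr j) (inr j'); exists p; split=> //.
apply: leq_trans r_m_le3; rewrite leq_min (size_gpath_Kmn jpj') andbT.
exact: size_rainbow_leq c_lt jpj' p_rainbow.
Qed.

Lemma strongly_rainbow_choosable_leq_expn (r : nat) :
  0 < m -> choosable (@strongly_rainbow_connected (Kmn m n)) r -> n <= r ^ m.
Proof.
move=> m_gt0 /choosable_bounded[c c_lt c_conn].
apply: (short_rainbow_paths_leq_expn c_lt) => j j' jj'.
have [p [[jpj' p_min] p_rainbow]] := c_conn (inr j) (inr j').
exists p; split=> //; pose i := Ordinal m_gt0.
apply: leq_trans (p_min [:: inl i; inr j'] _) _ => //.
by have [] := @geodesic_midpoint (Kmn m n) (inr j) (inl i) (inr j').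
Qed.

Lemma strongly_rainbow_choosable (r : nat) :
  m <= n -> n <= r ^ m -> choosable (@strongly_rainbow_connected (Kmn m n)) r.
Proof.
move=> m_le_n n_le_rX.
apply: (Kmn_choosable (P := fun C => rows_distinct C /\ columns_distinct C)).
  by move=> c []; exact: distinct_strongly_rainbow_connected.
by move=> s; exact: exists_distinct_rows_columns.
Qed.

Lemma rainbow_choosable (r : nat) :
  m <= n -> n <= r ^ m -> choosable (@rainbow_connected (Kmn m n)) r.
Proof.
move=> m_le_n n_le_rX; apply: choosable_sub.
  exact: strongly_rainbow_connectedW.
exact: strongly_rainbow_choosable.
Qed.

Lemma rainbow_choosable4 :
  1 < m -> m <= n -> choosable (@rainbow_connected (Kmn m n)) 4.
Proof.
move=> m_gt1 m_le_n.
apply: (Kmn_choosable (P := fun C =>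
  rows_distinct C /\ exists i0 i1 z, hub_column C i0 i1 z)).
  by move=> c [rows [i0 [i1 [z]]]]; exact: hub_column_rainbow_connected.
move=> s s_uniq s_size; apply: exists_hub_column => // i j.
by rewrite s_size.
Qed.

End CompleteBipartite.

Theorem theorem3p12 (R : realType) (m n : nat) (hm : 1 <= m) (hmn : m <= n) :
  ((m = 1 -> is_rcl (Kmn m n) n) /\
   (2 <= m -> is_rcl (Kmn m n) (minn (ceil_root R m n) 4))) /\
  is_srcl (Kmn m n) (ceil_root R m n).
Proof.
have n_le_rootX : n <= ceil_root R m n ^ m by rewrite -(ceil_root_leq R).
split; [split=> [m_1|m_gt1]; split|split].
- by apply: rainbow_choosable => //; rewrite m_1 expn1.
- move=> r /rainbow_choosable_leq_expn; rewrite m_1 expn1; apply.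
  by rewrite geq_min orbT.
- rewrite /minn; case: ifP => _; first exact: rainbow_choosable.
  exact: rainbow_choosable4.
- move=> r r_choosable; rewrite geq_min; have [_|r_le3] := leqP 4 r.
    by rewrite orbT.
  by rewrite ceil_root_leq // rainbow_choosable_leq_expn // geq_min -ltnS r_le3.
- exact: strongly_rainbow_choosable.
- by move=> r /(strongly_rainbow_choosable_leq_expn hm); rewrite ceil_root_leq.
Qed.
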